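(* Let $A$ be an ordered irreducible real symmetric $n\times n$ arrowhead matrix, $d_i$ one of its poles, and $$b=\frac{1}{\zeta_i^2}\left(-a+z_1^TD_1^{-1}z_1+z_2^TD_2^{-1}z_2\right).$$ If $-a>0$, set $$P=-a+z_1^TD_1^{-1}z_1,\qquad Q=-z_2^TD_2^{-1}z_2,$$ and if $-a<0$, set $$P=z_1^TD_1^{-1}z_1,\qquad Q=a-z_2^TD_2^{-1}z_2.$$ (In both cases $P,Q\ge0$ and $b=(P-Q)/\zeta_i^2$.) Let $\widetilde P=fl(P)$ and $\widetilde Q=fl(Q)$ be evaluated in standard precision $\varepsilon_M$. Assume that $\widetilde P\ne\widetilde Q$ and $K_b\le O(1/\varepsilon_M)$. If $P$, $Q$ and $b$ are all evaluated in double of the working precision, that is, with machine precision $\varepsilon_M^2$, then the computed value satisfies $\widetilde b=b(1+\kappa_b\varepsilon_M)$ with $|\kappa_b|\le O(n)$.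
   Context: **Arrowhead matrix.** $A=\begin{bmatrix} D & z\\ z^T&\alpha\end{bmatrix}\in\mathbb{R}^{n\times n}$ with $D=\mathrm{diag}(d_1,\dots,d_{n-1})$, $z=(\zeta_1,\dots,\zeta_{n-1})^T$, $\alpha\in\mathbb R$. Ordered and irreducible means $d_1>d_2>\dots>d_{n-1}$ and $\zeta_j\neq 0$ for all $j$. The $d_j$ are called poles. For the pole $d_i$: $D_1=\mathrm{diag}(d_1-d_i,\dots,d_{i-1}-d_i)$ (positive definite), $D_2=\mathrm{diag}(d_{i+1}-d_i,\dots,d_{n-1}-d_i)$ (negative definite), $z_1=(\zeta_1,\dots,\zeta_{i-1})^T$, $z_2=(\zeta_{i+1},\dots,\zeta_{n-1})^T$, $a=\alpha-d_i$. The number $b$ is the $(i,i)$ entry of $(A-d_iI)^{-1}$. Further $$K_b=\frac{|a|+|z_1^TD_1^{-1}z_1|+|z_2^TD_2^{-1}z_2|}{|-a+z_1^TD_1^{-1}z_1+z_2^TD_2^{-1}z_2|}.$$ **Floating point.** Inputs $d_j,\zeta_j,\alpha$ are exactly represented. Evaluation with machine precision $\varepsilon$ means each operation satisfies $fl(p\circ q)=(p\circ q)(1+\varepsilon_\circ)$, $|\varepsilon_\circ|\le\varepsilon$, $\circ\in\{+,-,*,/\}$; no overflow or underflow occurs. The standard precision is $\varepsilon=\varepsilon_M$; ''double of the working precision'' is $\varepsilon=\varepsilon_M^2$. $P$ and $Q$ are evaluated by computing the differences $d_j-d_i$ and $a=\alpha-d_i$, the terms $\zeta_j^2/(d_j-d_i)$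 and their sums; then $b$ is evaluated as $(P-Q)/\zeta_i^2$. Error bounds are first-order: higher-order terms are neglected. The $O$-notation means: for every constant $C$ there is a constant $C'$, depending only on $C$ (not on $n$, $A$, $i$, $\varepsilon_M$), such that $K_b\le C/\varepsilon_M$ implies $|\kappa_b|\le C'n$. In particular the assumption on $K_b$ includes that $K_b$ is finite, i.e. $b\ne0$.
   Formalization: Instead of neglecting higher-order terms, the bound on κ_b is proved for the exact computed value under the added assumption n·ε_M² ≤ 1; without such a smallness condition the exact bound O(n) fails, since rounding errors can grow like (1+ε_M²)^n. *)

(* Defs.v *)
From mathcomp Require Import all_boot all_order all_algebra.
From mathcomp Require Import reals.

Set Implicit Arguments.
Unset Strict Implicit.
Unset Printing Implicit Defensive.

Import Order.TTheory GRing.Theory Num.Theory.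

Local Open Scope ring_scope.

(* Throughout, m = n - 1 is the number of poles of an n x n arrowhead matrix;
   d lists the poles, z is the column of the arrow and alpha its tip. *)

Definition arrowhead (R : realType) (m : nat) (d : 'rV[R]_m) (z : 'cV[R]_m)
    (alpha : R) : 'M[R]_(m + 1) :=
  block_mx (diag_mx d) z z^T alpha%:M.

Definition ordered (R : realType) (m : nat) (d : 'rV[R]_m) : Prop :=
  forall j k : 'I_m, (j < k)%N -> d 0 k < d 0 j.

Definition irreducible (R : realType) (m : nat) (z : 'cV[R]_m) : Prop :=
  forall j : 'I_m, z j 0 != 0.

(* The embeddings of the positions 0, ..., i-1 and i+1, ..., m-1 into 'I_m. *)
Definition before (m : nat) (i : 'I_m) (j : 'I_i) : 'I_m :=
  widen_ord (ltnW (ltn_ord i)) j.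

Definition after (m : nat) (i : 'I_m) (j : 'I_(m - i.+1)) : 'I_m :=
  cast_ord (subnKC (ltn_ord i)) (rshift i.+1 j).

Definition D1 (R : realType) (m : nat) (d : 'rV[R]_m) (i : 'I_m) : 'M[R]_i :=
  diag_mx (\row_(j < i) (d 0 (before j) - d 0 i)).

Definition D2 (R : realType) (m : nat) (d : 'rV[R]_m) (i : 'I_m) :
    'M[R]_(m - i.+1) :=
  diag_mx (\row_(j < m - i.+1) (d 0 (after j) - d 0 i)).

Definition z1 (R : realType) (m : nat) (z : 'cV[R]_m) (i : 'I_m) : 'cV[R]_i :=
  \col_(j < i) z (before j) 0.

Definition z2 (R : realType) (m : nat) (z : 'cV[R]_m) (i : 'I_m) :
    'cV[R]_(m - i.+1) :=
  \col_(j < m - i.+1) z (after j) 0.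

Definition zDz1 (R : realType) (m : nat) (d : 'rV[R]_m) (z : 'cV[R]_m)
    (i : 'I_m) : R :=
  ((z1 z i)^T *m invmx (D1 d i) *m z1 z i) 0 0.

Definition zDz2 (R : realType) (m : nat) (d : 'rV[R]_m) (z : 'cV[R]_m)
    (i : 'I_m) : R :=
  ((z2 z i)^T *m invmx (D2 d i) *m z2 z i) 0 0.

Definition shifted_tip (R : realType) (m : nat) (d : 'rV[R]_m) (alpha : R)
    (i : 'I_m) : R :=
  alpha - d 0 i.

Definition b_val (R : realType) (m : nat) (d : 'rV[R]_m) (z : 'cV[R]_m)
    (alpha : R) (i : 'I_m) : R :=
  1 / z i 0 ^+ 2 * (- shifted_tip d alpha i + zDz1 d z i + zDz2 d z i).

(* Meaningful only when b_val is nonzero: otherwise the denominator vanishes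
   and the totalized division returns 0. *)
Definition K_b (R : realType) (m : nat) (d : 'rV[R]_m) (z : 'cV[R]_m)
    (alpha : R) (i : 'I_m) : R :=
  (`|shifted_tip d alpha i| + `|zDz1 d z i| + `|zDz2 d z i|)
  / `|- shifted_tip d alpha i + zDz1 d z i + zDz2 d z i|.

(* [fl eps x y]: y is a possible result of an operation with exact result x,
   performed with machine precision eps. *)
Definition fl (R : realType) (eps x y : R) : Prop :=
  exists2 e : R, `|e| <= eps & y = x * (1 + e).

(* [fl_sum eps s y]: y is a possible result of adding up the entries of s, in
   any order and with any bracketing. Both parts of a split are nonempty, so
   that a sum of k > 0 terms costs exactly k - 1 rounded additions. *)
Inductive fl_sum (R : realType) (eps : R) : seq R -> R -> Prop :=
| fl_sum_nil : fl_sum eps [::] 0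
| fl_sum_one (x : R) : fl_sum eps [:: x] x
| fl_sum_add (s s1 s2 : seq R) (x1 x2 y : R) :
    s1 != [::] -> s2 != [::] -> perm_eq s (s1 ++ s2) ->
    fl_sum eps s1 x1 -> fl_sum eps s2 x2 -> fl eps (x1 + x2) y ->
    fl_sum eps s y.

Definition fl_term (R : realType) (m : nat) (eps : R) (d : 'rV[R]_m)
    (z : 'cV[R]_m) (i j : 'I_m) (t : R) : Prop :=
  exists p q : R,
    [/\ fl eps (z j 0 * z j 0) p, fl eps (d 0 j - d 0 i) q & fl eps (p / q) t].

(* P and Q are only used when the shifted tip a is nonzero, so the else-branch
   below is the case - a < 0. Changes of sign are exact. *)
Definition P_val (R : realType) (m : nat) (d : 'rV[R]_m) (z : 'cV[R]_m)
    (alpha : R) (i : 'I_m) : R :=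
  let a := shifted_tip d alpha i in
  if 0 < - a then - a + zDz1 d z i else zDz1 d z i.

Definition Q_val (R : realType) (m : nat) (d : 'rV[R]_m) (z : 'cV[R]_m)
    (alpha : R) (i : 'I_m) : R :=
  let a := shifted_tip d alpha i in
  if 0 < - a then - zDz2 d z i else a - zDz2 d z i.

Definition fl_P (R : realType) (m : nat) (eps : R) (d : 'rV[R]_m)
    (z : 'cV[R]_m) (alpha : R) (i : 'I_m) (y : R) : Prop :=
  exists (a : R) (t : 'I_m -> R),
    [/\ fl eps (alpha - d 0 i) a,
        forall j : 'I_m, (j < i)%N -> fl_term eps d z i j (t j)
      & fl_sum eps ((if 0 < - shifted_tip d alpha i then [:: - a] else [::])
                      ++ [seq t j | j : 'I_m <- enum 'I_m & (j < i)%N]) y].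

Definition fl_Q (R : realType) (m : nat) (eps : R) (d : 'rV[R]_m)
    (z : 'cV[R]_m) (alpha : R) (i : 'I_m) (y : R) : Prop :=
  exists (a : R) (t : 'I_m -> R),
    [/\ fl eps (alpha - d 0 i) a,
        forall j : 'I_m, (i < j)%N -> fl_term eps d z i j (t j)
      & fl_sum eps ((if 0 < - shifted_tip d alpha i then [::] else [:: a])
                      ++ [seq - t j | j : 'I_m <- enum 'I_m & (i < j)%N]) y].

Definition fl_b (R : realType) (m : nat) (eps : R) (z : 'cV[R]_m) (i : 'I_m)
    (P Q y : R) : Prop :=
  exists s p : R,
    [/\ fl eps (P - Q) s, fl eps (z i 0 * z i 0) p & fl eps (s / p) y].

Definition fl_b_val (R : realType) (m : nat) (eps : R) (d : 'rV[R]_m)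
    (z : 'cV[R]_m) (alpha : R) (i : 'I_m) (y : R) : Prop :=
  exists P Q : R,
    [/\ fl_P eps d z alpha i P, fl_Q eps d z alpha i Q & fl_b eps z i P Q y].

(* Main.v *)
(* Every rounding multiplies by a factor within [u] of 1, where [u = epsM ^ 2],
   and all the terms summed in [P] and in [Q] are nonnegative, so both values
   are computed with relative error O(n u). The subtraction [P - Q] amplifies
   this by (P + Q) / |P - Q| = [K_b], and u K_b <= C epsM, which leaves a
   relative error O(n epsM) in [b]. *)
Require Import Defs.
From mathcomp Require Import all_boot all_order all_algebra.
From mathcomp Require Import reals zify ring lra.

Import Order.TTheory GRing.Theory Num.Theory.

Local Open Scope ring_scope.

(* [near u k x y]: y is x up to the relative error of k roundings. *)
Definition near {R : realType} (u : R) (k : nat) (x y : R) : Prop :=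
  `|y - x| <= ((1 + u) ^+ k - 1) * `|x|.

(** * Powers of [1 + u] *)

Lemma expr1D_ge1 {R : realType} (u : R) k : 0 <= u -> 1 <= (1 + u) ^+ k.
Proof. by move=> u0; apply: exprn_ege1; rewrite lerDl. Qed.

Lemma expr1D_leq {R : realType} (u : R) k l :
  0 <= u -> (k <= l)%N -> (1 + u) ^+ k <= (1 + u) ^+ l.
Proof. by move=> u0 kl; apply: ler_weXn2l => //; rewrite lerDl. Qed.

(** In the inductive step the new term [k^2 u^3] fits into the slack of [(k + 1)^2 u^2], because
    [k u <= 1]. *)
Lemma expr1D_le_quad {R : realType} (u : R) k : 0 <= u -> k%:R * u <= 1 ->
  (1 + u) ^+ k <= 1 + k%:R * u + (k%:R * u) ^+ 2.
Proof.
move=> u0; elim: k => [|k IH] ku; first by rewrite expr0; lra.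
have k0 : 0 <= k%:R :> R by rewrite ler0n.
move: ku; rewrite -natr1 => ku; have {}IH := IH ltac:(nra).
rewrite exprSr; apply: le_trans (ler_wpM2r _ IH) _; first by lra.
by nra.
Qed.

(* [26] bounds [((1 + 2 x) ^ 3 - 1) / x] for [0 < x <= 1], where [x = n u]. *)
Lemma expr1D_sub1_le {R : realType} (u : R) n k :
  0 <= u -> n%:R * u <= 1 -> (k <= 3 * n)%N ->
  (1 + u) ^+ k - 1 <= 26 * (n%:R * u).
Proof.
move=> u0 nu kn; have n0 : 0 <= n%:R * u by rewrite mulr_ge0.
have := expr1D_le_quad u n u0 nu; have := expr1D_ge1 u n u0.
have := expr1D_leq u k (3 * n) u0 kn; rewrite mulnC exprM.
move: ((1 + u) ^+ n) (n%:R * u) nu n0 => w x x1 x0 le_k w1 wx.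
have w2 : w <= 1 + 2 * x by nra.
have : w ^+ 3 <= (1 + 2 * x) ^+ 3 by rewrite lerXn2r // nnegrE; lra.
have x2 : x ^+ 2 <= x by nra.
have x3 : x ^+ 3 <= x by rewrite exprS; nra.
have -> : (1 + 2 * x) ^+ 3 = 1 + 6 * x + 12 * x ^+ 2 + 8 * x ^+ 3 by ring.
lra.
Qed.

(** * Calculus of relative errors *)

Lemma near_leq {R : realType} (u : R) k l x y :
  0 <= u -> (k <= l)%N -> near u k x y -> near u l x y.
Proof.
move=> u0 kl; rewrite /near => /le_trans; apply.
by rewrite ler_wpM2r // lerB // expr1D_leq.
Qed.

Lemma near_norm_le {R : realType} (u : R) k x y :
  near u k x y -> `|y| <= (1 + u) ^+ k * `|x|.
Proof.
rewrite /near => H; have -> : y = (y - x) + x by ring.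
by apply: le_trans (ler_normD _ _) _; nra.
Qed.

(** Measuring errors by [(1 + u) ^+ k - 1] makes them compose without loss: the factors multiply, so
    the rounding counts add. *)
Lemma near_trans {R : realType} (u : R) k l x y w : 0 <= u ->
  near u k x y -> near u l y w -> near u (k + l) x w.
Proof.
move=> u0 xy yw; have y_le := near_norm_le _ _ _ _ xy.
have l1 := expr1D_ge1 u l u0.
have -> : near u (k + l) x w <-> `|(w - y) + (y - x)| <=
    ((1 + u) ^+ k * (1 + u) ^+ l - 1) * `|x|.
  by rewrite /near exprD addrA subrK.
by apply: le_trans (ler_normD _ _) _; move: xy yw; rewrite /near; nra.
Qed.

Lemma nearN {R : realType} (u : R) k x y : near u k x y -> near u k (- x) (- y).
Proof. by rewrite /near -opprD !normrN. Qed.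

Lemma nearMl {R : realType} (u : R) k c x y :
  near u k x y -> near u k (c * x) (c * y).
Proof.
by rewrite /near -mulrBr !normrM mulrCA => H; rewrite ler_wpM2l.
Qed.

Lemma nearM {R : realType} (u : R) k l x y x' y' : 0 <= u ->
  near u k x y -> near u l x' y' -> near u (k + l) (x * x') (y * y').
Proof.
move=> u0 xy xy'; apply: (@near_trans _ u k l _ (y * x')) => //.
  by rewrite ![_ * x']mulrC; apply: nearMl.
exact: nearMl.
Qed.

(** * Rounded operations, sums and pole terms *)

Lemma fl_near {R : realType} (u x y : R) : fl u x y -> near u 1 x y.
Proof.
case=> e eu ->; rewrite /near expr1 (_ : x * (1 + e) - x = e * x); last by ring.
by rewrite normrM ler_wpM2r //; lra.
Qed.

(** A rounded divisor changes the reciprocal by the relative amount [e / (1 + e)], at most [2 u] in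
    size when [u <= 1 / 2]; this is charged as two roundings. *)
Lemma fl_nearV {R : realType} (u x y : R) : u <= 1 / 2 ->
  fl u x y -> near u 2 x^-1 y^-1.
Proof.
move=> u2 [e eu ->]; have := eu; rewrite ler_norml => /andP[e1 e2].
have e0 : 1 + e != 0 by rewrite gt_eqF //; lra.
rewrite /near invfM mulrC.
have -> : (1 + e)^-1 * x^-1 - x^-1 = - (e / (1 + e)) * x^-1.
  rewrite -[in X in _ - X](mul1r x^-1) -mulrBl; congr (_ * _).
  by field.
rewrite normrM ler_wpM2r // normrN normrM normfV.
rewrite ler_pdivrMr ?normr_gt0 // (ger0_norm (x := 1 + e)); last by lra.
apply: le_trans eu _; have -> : (1 + u) ^+ 2 - 1 = 2 * u + u ^+ 2 by ring.
by nra.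
Qed.

(** Induction on the bracketing: each addition contributes one more factor [1 + u] on top of the
    errors of its two parts. *)
Lemma fl_sum_error {R : realType} (u : R) s y : 0 <= u -> fl_sum u s y ->
  `|y - \sum_(x <- s) x| <= ((1 + u) ^+ size s - 1) * \sum_(x <- s) `|x|.
Proof.
move=> u0; elim=> {s y} [|x|s s1 s2 x1 x2 y n1 n2 ss _ IH1 _ IH2 flxy].
- by rewrite !big_nil subrr normr0 mulr0.
- rewrite !big_seq1 subrr normr0 mulr_ge0 // subr_ge0; exact: expr1D_ge1.
rewrite !(perm_big _ ss) !big_cat (perm_size ss) size_cat /=.
move: IH1 IH2; set S1 := \sum_(x <- s1) x; set S2 := \sum_(x <- s2) x.
set T1 := \sum_(x <- s1) _; set T2 := \sum_(x <- s2) _ => IH1 IH2.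
have ST1 : `|S1| <= T1 by exact: ler_norm_sum.
have ST2 : `|S2| <= T2 by exact: ler_norm_sum.
(* As neither part is empty, both sizes are at most [k], which leaves one factor [1 + u] for the
   last addition. *)
set k := (size s1 + size s2).-1.
have ek : (size s1 + size s2 = k.+1)%N.
  by rewrite prednK // addn_gt0 lt0n size_eq0 n1.
have k1 : (size s1 <= k)%N.
  by rewrite -ltnS -ek -[X in (X < _)%N]addn0 ltn_add2l lt0n size_eq0.
have k2 : (size s2 <= k)%N.
  by rewrite -ltnS -ek -[X in (X < _)%N]add0n ltn_add2r lt0n size_eq0.
have g1 := expr1D_leq u _ _ u0 k1; have g2 := expr1D_leq u _ _ u0 k2.
have := fl_near _ _ _ flxy; rewrite /near expr1 ek exprS => xy.
have T10 : 0 <= T1 by exact: le_trans (normr_ge0 _) ST1.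
have T20 : 0 <= T2 by exact: le_trans (normr_ge0 _) ST2.
have {}IH1 : `|x1 - S1| <= ((1 + u) ^+ k - 1) * T1 by nra.
have {}IH2 : `|x2 - S2| <= ((1 + u) ^+ k - 1) * T2 by nra.
have d12 : `|(x1 + x2) - (S1 + S2)| <= ((1 + u) ^+ k - 1) * (T1 + T2).
  rewrite opprD addrACA mulrDr.
  by apply: le_trans (ler_normD _ _) _; apply: lerD.
have x12 : `|x1 + x2| <= (1 + u) ^+ k * (T1 + T2).
  have -> : x1 + x2 = ((x1 + x2) - (S1 + S2)) + (S1 + S2) by ring.
  have S12 := ler_normD S1 S2; apply: le_trans (ler_normD _ _) _; nra.
have -> : y - (S1 + S2) = (y - (x1 + x2)) + ((x1 + x2) - (S1 + S2)) by ring.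
by apply: le_trans (ler_normD _ _) _; nra.
Qed.

(* The pairs in [h] consist of an exact nonnegative summand and its computed
   value. *)
Lemma fl_sum_near {R : realType} (u : R) k (h : seq (R * R)) y : 0 <= u ->
  (forall p, p \in h -> 0 <= p.1 /\ near u k p.1 p.2) ->
  fl_sum u (unzip2 h) y -> near u (k + size h) (\sum_(p <- h) p.1) y.
Proof.
move=> u0 hP /(fl_sum_error _ _ _ u0); rewrite size_map !big_map /near => Hy.
(* Without cancellation the sum of the absolute values is the sum itself, so the absolute bound
   becomes a relative one. *)
have S0 : 0 <= \sum_(p <- h) p.1.
  by rewrite big_seq sumr_ge0 // => p /hP[].
rewrite (ger0_norm S0).
have H1 : `|\sum_(p <- h) p.2 - \sum_(p <- h) p.1|
    <= ((1 + u) ^+ k - 1) * \sum_(p <- h) p.1.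
  rewrite -sumrB mulr_sumr; apply: le_trans (ler_norm_sum _ _ _) _.
  rewrite big_seq [leRHS]big_seq; apply: ler_sum => p /hP[p0].
  by rewrite /near (ger0_norm p0).
have H2 : \sum_(p <- h) `|p.2| <= (1 + u) ^+ k * \sum_(p <- h) p.1.
  rewrite mulr_sumr big_seq [leRHS]big_seq; apply: ler_sum => p /hP[p0].
  by move=> /near_norm_le; rewrite (ger0_norm p0).
have l1 := expr1D_ge1 u (size h) u0.
rewrite exprD.
have -> : y - \sum_(p <- h) p.1 = (y - \sum_(p <- h) p.2)
  + (\sum_(p <- h) p.2 - \sum_(p <- h) p.1) by ring.
apply: le_trans (ler_normD _ _) _.
by move: l1 H1 H2 Hy S0; move: (\sum_(p <- h) `|p.2|) => ?; nra.
Qed.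

(** Four roundings: one for the square, two for the reciprocal of the rounded difference, one for
    the division. *)
Lemma fl_term_near {R : realType} (m : nat) (u : R) (d : 'rV[R]_m)
    (z : 'cV[R]_m) (i j : 'I_m) (t : R) : 0 <= u -> u <= 1 / 2 ->
  fl_term u d z i j t -> near u 4 (z j 0 ^+ 2 / (d 0 j - d 0 i)) t.
Proof.
move=> u0 u2 [p [q [/fl_near flp /(fl_nearV _ _ _ u2) flq /fl_near flt]]].
rewrite expr2; apply: (@near_trans _ u 3 1) flt => //.
exact: (@nearM _ u 1 2).
Qed.

(** Common shape of [P] and [Q]: the list [h] holds the shifted tip or is empty. With 4 roundings
    per summand and at most [m + 1] summands, the count is [m + 5]. *)
Lemma fl_head_terms_near {R : realType} (m : nat) (u : R) (p : pred 'I_m)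
    (x t : 'I_m -> R) (h : seq (R * R)) (y : R) : 0 <= u -> (size h <= 1)%N ->
  (forall c, c \in h -> 0 <= c.1 /\ near u 4 c.1 c.2) ->
  (forall j, p j -> 0 <= x j /\ near u 4 (x j) (t j)) ->
  fl_sum u (unzip2 h ++ [seq t j | j <- enum 'I_m & p j]) y ->
  near u (m + 5) (\sum_(c <- h) c.1 + \sum_(j | p j) x j) y.
Proof.
move=> u0 h1 hh ht; set s := [seq (x j, t j) | j <- enum 'I_m & p j].
have -> : unzip2 h ++ [seq t j | j <- enum 'I_m & p j] = unzip2 (h ++ s).
  by rewrite /unzip2 map_cat -map_comp.
move=> /(@fl_sum_near _ u 4) hy.
have -> : \sum_(c <- h) c.1 + \sum_(j | p j) x j = \sum_(c <- h ++ s) c.1.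
  by rewrite big_cat big_map big_filter big_enum_cond.
apply: near_leq (hy u0 _) => //.
  rewrite size_cat size_map size_filter.
  have := count_size p (enum 'I_m); rewrite size_enum_ord.
  by move: h1; set k1 := size h; set k2 := count _ _; lia.
move=> c; rewrite mem_cat => /orP[/hh //|/mapP[j]].
by rewrite mem_filter => /andP[/ht ? _] ->.
Qed.

(** * The quadratic forms as sums over poles, and their signs *)

Lemma diag_quad {R : realType} (k : nat) (v : 'rV[R]_k) (w : 'cV[R]_k) :
  (forall j, v 0 j != 0) ->
  (w^T *m invmx (diag_mx v) *m w) 0 0 = \sum_j w j 0 ^+ 2 / v 0 j.
Proof.
move=> v0; set v' := \row_j (v 0 j)^-1.
have vv' : diag_mx v *m diag_mx v' = 1%:M.
  rewrite mulmx_diag -diag_const_mx; congr diag_mx.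
  by apply/rowP => j; rewrite !mxE divff.
have [vU _] := mulmx1_unit vv'.
have -> : invmx (diag_mx v) = diag_mx v'.
  by rewrite -[LHS]mulmx1 -vv' mulKmx.
rewrite !mxE; apply: eq_bigr => j _.
by rewrite mul_mx_diag !mxE mulrAC expr2.
Qed.

Section Poles.

Context {R : realType} (m : nat) (d : 'rV[R]_m) (z : 'cV[R]_m) (i : 'I_m).
Hypothesis d_ord : ordered d.

Let term (j : 'I_m) : R := z j 0 ^+ 2 / (d 0 j - d 0 i).

Lemma zDz1E : zDz1 d z i = \sum_(j < m | (j < i)%N) term j.
Proof.
rewrite /zDz1 /D1 diag_quad => [|j]; last first.
  by rewrite mxE subr_eq0 gt_eqF // d_ord /=.
rewrite (big_ord_narrow (ltnW (ltn_ord i))).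
by apply: eq_bigr => j _; rewrite !mxE.
Qed.

Lemma zDz2E : zDz2 d z i = \sum_(j < m | (i < j)%N) term j.
Proof.
rewrite /zDz2 /D2 diag_quad => [|j]; last first.
  by rewrite mxE subr_eq0 lt_eqF // d_ord //= ltnS leq_addr.
rewrite [RHS](reindex (cast_ord (subnKC (ltn_ord i)))) /=; last first.
  by apply: onW_bij; exists (cast_ord (esym (subnKC (ltn_ord i))));
    [apply: cast_ordK | apply: cast_ordKV].
(* The first [i + 1] indices violate [i < j] and contribute nothing. *)
rewrite big_split_ord /= [X in _ = X + _]big_pred0 => [|j]; last first.
  by rewrite ltnNge -ltnS ltn_ord.
rewrite add0r; apply: eq_big => [j|j _]; first by rewrite ltnS leq_addr.
by rewrite !mxE.
Qed.

(** The decreasing order of the poles fixes the sign of each term on either side of [i]; hence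
    nothing cancels within [P] or within [Q]. *)
Lemma term_ge0 (j : 'I_m) : (j < i)%N -> 0 <= term j.
Proof.
by move=> /d_ord ji; rewrite divr_ge0 ?sqr_ge0 // subr_ge0 ltW.
Qed.

Lemma opp_term_ge0 (j : 'I_m) : (i < j)%N -> 0 <= - term j.
Proof.
move=> /d_ord ij; rewrite oppr_ge0 mulr_ge0_le0 ?sqr_ge0 //.
by rewrite invr_le0 subr_le0 ltW.
Qed.

Lemma zDz1_ge0 : 0 <= zDz1 d z i.
Proof. by rewrite zDz1E sumr_ge0 // => j /term_ge0. Qed.

Lemma opp_zDz2_ge0 : 0 <= - zDz2 d z i.
Proof. by rewrite zDz2E -sumrN sumr_ge0 // => j /opp_term_ge0. Qed.

(** * Errors of the computed [P] and [Q] *)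

Lemma fl_P_near (u alpha y : R) : 0 <= u -> u <= 1 / 2 ->
  fl_P u d z alpha i y -> near u (m + 5) (P_val d z alpha i) y.
Proof.
move=> u0 u2 [a [t [/fl_near fa ft]]]; rewrite /P_val zDz1E.
have ht (j : 'I_m) : (j < i)%N -> 0 <= term j /\ near u 4 (term j) (t j).
  by move=> ji; split; [exact: term_ge0 | exact: fl_term_near (ft _ ji)].
case: ifPn => a0.
  (* The tip is paired with its computed value; its single rounding is relaxed to 4. *)
  rewrite -[[:: - a]]/(unzip2 [:: (- shifted_tip d alpha i, - a)]).
  move=> /fl_head_terms_near => /(_ term); rewrite big_seq1; apply=> // c.
  rewrite inE => /eqP->; split; first exact: ltW.
  exact/nearN/(@near_leq _ u 1).
move=> /(@fl_head_terms_near _ _ _ _ term _ [::]).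
by rewrite big_nil add0r; apply.
Qed.

Lemma fl_Q_near (u alpha y : R) : 0 <= u -> u <= 1 / 2 ->
  fl_Q u d z alpha i y -> near u (m + 5) (Q_val d z alpha i) y.
Proof.
move=> u0 u2 [a [t [/fl_near fa ft]]]; rewrite /Q_val zDz2E -sumrN.
have ht (j : 'I_m) : (i < j)%N -> 0 <= - term j /\ near u 4 (- term j) (- t j).
  move=> ij; split; first exact: opp_term_ge0.
  exact: nearN (fl_term_near _ _ _ _ _ _ _ u0 u2 (ft _ ij)).
case: ifPn => a0.
  move=> /(@fl_head_terms_near _ _ _ _ (fun j => - term j) _ [::]).
  by rewrite big_nil add0r; apply.
rewrite -[[:: a]]/(unzip2 [:: (shifted_tip d alpha i, a)]).
move=> /fl_head_terms_near => /(_ (fun j => - term j)); rewrite big_seq1.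
apply=> // c; rewrite inE => /eqP->; split; last exact: (@near_leq _ u 1).
by move: a0; rewrite -leNgt oppr_le0.
Qed.

End Poles.

(** * The error of [b] *)

(** Applied to the already computed [P] and [Q], so the cancellation in [P - Q] is not yet charged
    here. *)
Lemma fl_b_near {R : realType} (m : nat) (u : R) (z : 'cV[R]_m) (i : 'I_m)
    (P Q y : R) : 0 <= u -> u <= 1 / 2 ->
  fl_b u z i P Q y -> near u 4 ((P - Q) / z i 0 ^+ 2) y.
Proof.
move=> u0 u2 [s [p [/fl_near fs /(fl_nearV _ _ _ u2) fp /fl_near fy]]].
rewrite expr2; apply: (@near_trans _ u 3 1) fy => //.
exact: (@nearM _ u 1 2).
Qed.

Theorem theorem7 (R : realType) :
  forall C : R, exists C' : R,
  forall (m : nat) (A : 'M[R]_(m + 1)) (d : 'rV[R]_m) (z : 'cV[R]_m)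
    (alpha : R) (i : 'I_m),
    A = arrowhead d z alpha -> ordered d -> irreducible z ->
    shifted_tip d alpha i != 0 ->
    [/\ 0 <= P_val d z alpha i, 0 <= Q_val d z alpha i
      & b_val d z alpha i
        = (P_val d z alpha i - Q_val d z alpha i) / z i 0 ^+ 2] /\
    forall epsM Pt Qt bt : R,
      0 < epsM -> (m + 1)%:R * epsM ^+ 2 <= 1 ->
      fl_P epsM d z alpha i Pt -> fl_Q epsM d z alpha i Qt -> Pt != Qt ->
      b_val d z alpha i != 0 -> K_b d z alpha i <= C / epsM ->
      fl_b_val (epsM ^+ 2) d z alpha i bt ->
      exists kappa : R,
        bt = b_val d z alpha i * (1 + kappa * epsM) /\
        `|kappa| <= C' * (m + 1)%:R.
Proof.
(* The errors of [P] and [Q] give [26 |C|], the last operations give [26 (1 + 26 |C|)]; the sum is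
   [26 (1 + 27 |C|)]. *)
move=> C; exists (26 * (1 + 27 * `|C|)) => m A d z alpha i _ d_ord _ _.
have Z1 := zDz1_ge0 m d z i d_ord; have Z2 := opp_zDz2_ge0 m d z i d_ord.
have P0 : 0 <= P_val d z alpha i.
  by rewrite /P_val; case: ifPn => // a0; rewrite addr_ge0 // ltW.
have Q0 : 0 <= Q_val d z alpha i.
  rewrite /Q_val; case: ifPn => //; rewrite -leNgt oppr_le0 => a0.
  by rewrite addr_ge0.
have PBQ : - shifted_tip d alpha i + zDz1 d z i + zDz2 d z i
    = P_val d z alpha i - Q_val d z alpha i.
  by rewrite /P_val /Q_val; case: ifP => _; ring.
have bE : b_val d z alpha i
    = (P_val d z alpha i - Q_val d z alpha i) / z i 0 ^+ 2.
  by rewrite /b_val PBQ div1r mulrC.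
split=> // e Pt Qt bt e0; set u := e ^+ 2; set n := (m + 1)%N.
move=> nu _ _ _ b0 Kb [P [Q [flP flQ flb]]].
(* The existence of the pole index [i] forces [m >= 1]; this yields [u <= 1 / 2] and
   [m + 5 = n + 4 <= 3 n]. *)
have n2 : (2 <= n)%N by rewrite /n addn1 ltnS (leq_ltn_trans _ (ltn_ord i)).
have n2R : 2 <= n%:R :> R by rewrite ler_nat.
have u0 : 0 <= u by rewrite sqr_ge0.
have u2 : u <= 1 / 2 by nra.
have e1 : e <= 1 by rewrite -(expr_le1 (n := 2)) // ?ltW // -/u; lra.
have {}flP := fl_P_near m d z i d_ord _ _ _ u0 u2 flP.
have {}flQ := fl_Q_near m d z i d_ord _ _ _ u0 u2 flQ.
have {}flb := fl_b_near m _ z i _ _ _ u0 u2 flb.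
have PDQ : `|shifted_tip d alpha i| + `|zDz1 d z i| + `|zDz2 d z i|
    = P_val d z alpha i + Q_val d z alpha i.
  rewrite (ger0_norm Z1) -(normrN (zDz2 d z i)) (ger0_norm Z2) /P_val /Q_val.
  case: ifPn => a0; first by rewrite -normrN gtr0_norm //; ring.
  by move: a0; rewrite -leNgt oppr_le0 => a0; rewrite ger0_norm //; ring.
move: Kb flP flQ flb b0; rewrite /K_b PDQ PBQ {PBQ PDQ} bE {bE}.
move: (P_val d z alpha i) (Q_val d z alpha i) P0 Q0 => p q p0 q0.
rewrite /near (ger0_norm p0) (ger0_norm q0).
have m5 : (m + 5 <= 3 * n)%N by rewrite /n in n2 *; lia.
have n4 : (4 <= 3 * n)%N by lia.
have := expr1D_sub1_le u n _ u0 nu m5; have := expr1D_sub1_le u n _ u0 nu n4.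
move: ((1 + u) ^+ (m + 5)) ((1 + u) ^+ 4) => c5 c4 c4n c5n Kb HP HQ Hb b0.
set zi := z i 0 ^+ 2 in Hb b0 *.
set b := (p - q) / zi in b0 *; set b' := (P - Q) / zi in Hb.
have pq0 : 0 < `|p - q|.
  by rewrite normr_gt0; apply: contra_neq b0 => pq; rewrite /b pq mul0r.
(* Here the doubled precision pays off: one factor of [u = e ^+ 2] cancels the [1 / e] in the bound
   on [K_b]. *)
have uK : u * (p + q) <= e * `|C| * `|p - q|.
  have : p + q <= C / e * `|p - q| by rewrite -ler_pdivrMr.
  move=> /(ler_wpM2l u0) /le_trans; apply.
  have -> : u * (C / e * `|p - q|) = e * C * `|p - q|.
    by rewrite /u; field; rewrite gt_eqF.
  by rewrite ler_wpM2r // ler_wpM2l ?(ltW e0) // ler_norm.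
have HPQ : `|(P - Q) - (p - q)| <= 26 * n%:R * e * `|C| * `|p - q|.
  have -> : (P - Q) - (p - q) = (P - p) - (Q - q) by ring.
  apply: le_trans (ler_normB _ _) _.
  apply: (@le_trans _ _ (26 * (n%:R * u) * (p + q))); first by nra.
  by have := ler_wpM2l (_ : 0 <= 26 * n%:R) uK; lra.
have Hb' : `|b' - b| <= 26 * n%:R * e * `|C| * `|b|.
  rewrite /b' /b -mulrBl !normrM mulrA.
  by rewrite ler_wpM2r.
(* Compare through [b'], the exact quotient formed from the computed [P] and [Q]. *)
have Hbb : `|bt - b| <= 26 * (1 + 27 * `|C|) * n%:R * e * `|b|.
  have Nb' : `|b'| <= `|b' - b| + `|b|.
    by rewrite -[X in `|X| <= _](subrK b) ler_normD.
  have Hb1 : `|bt - b'| <= 26 * (n%:R * u) * `|b'|.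
    by apply: le_trans Hb _; rewrite ler_wpM2r.
  have -> : bt - b = (bt - b') + (b' - b) by ring.
  apply: le_trans (ler_normD _ _) _.
  set X := n%:R * e * `|b|.
  have nu0 : 0 <= n%:R * u by rewrite mulr_ge0.
  have X0 : 0 <= X by rewrite !mulr_ge0 // ltW.
  (* Since [e <= 1], also [u <= e]. *)
  have uX : n%:R * u * `|b| <= X.
    rewrite /X ler_wpM2r // ler_wpM2l // /u expr2; nra.
  have {}Hb' : `|b' - b| <= 26 * (`|C| * X) by rewrite /X; lra.
  have CX0 : 0 <= `|C| * X by rewrite mulr_ge0.
  have -> : 26 * (1 + 27 * `|C|) * n%:R * e * `|b| = 26 * X + 702 * (`|C| * X).
    by rewrite /X; ring.
  have : n%:R * u * `|b'| <= 26 * (`|C| * X) + X.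
    apply: le_trans (ler_wpM2l nu0 Nb') _; rewrite mulrDr lerD //.
    by have := normr_ge0 (b' - b); nra.
  lra.
(* The relative error of [bt] in units of [e]. *)
exists ((bt - b) / b / e); split.
  by field; rewrite b0 gt_eqF.
rewrite !normrM !normfV (gtr0_norm e0) ler_pdivrMr // ler_pdivrMr ?normr_gt0 //.
Qed.
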